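(* Let $n \geq 3$. Let $T_1$ and $T_2$ be $n$-leaf path trees, and suppose that for some $i$ the $i$th leaf is a bottom leaf both in $T_1$ and in $T_2$. Then $T_1$ and $T_2$ both parse the word $0^{k-1} 1 0^{n-k}$ for some $2 \leq k \leq n - 1$.
   Context: A binary tree is a rooted ordered tree in which each vertex has either $0$ or $2$ children; its leaves are numbered $1,2,\dots$ from left to right. Let $G$ be the context-free grammar with start symbols $0,1,2$ and rules $0\to 12$, $0\to 21$, $1\to 02$, $1\to 20$, $2\to 01$, $2\to 10$. An $n$-leaf binary tree $T$ parses a word $w$ of length $n$ on $\{0,1,2\}$ if there is a labeling of the vertices of $T$ by $0,1,2$ such that the leaves, from left to right, are labeled with the letters of $w$, and at every internal vertex the label of the vertex together with the labels of its left and right children form a rule of $G$ (i.e. the three labels are pairwise distinct). The level of a vertex is its distance from the root. A path tree is a binary tree with at most two vertices on each level. The two leaves on level $n-1$ of an $n$-leaf path tree are called its bottom leaves. *)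

(* Defs.v *)
From mathcomp Require Import all_boot all_order all_algebra.

Set Implicit Arguments.
Unset Strict Implicit.
Unset Printing Implicit Defensive.

Inductive btree : Type :=
| Leaf
| Node (l r : btree).

(* A vertex is represented by its address: the sequence of turns leading to it
   from the root, with [false] for left and [true] for right. *)
Definition vertex := seq bool.

Fixpoint vertices (T : btree) : seq vertex :=
  match T with
  | Leaf => [:: [::]]
  | Node l r => [::] :: [seq false :: v | v <- vertices l]
                     ++ [seq true :: v | v <- vertices r]
  end.

(* Listed from left to right. *)
Fixpoint leaves (T : btree) : seq vertex :=
  match T with
  | Leaf => [:: [::]]
  | Node l r => [seq false :: v | v <- leaves l]
             ++ [seq true :: v | v <- leaves r]
  end.

Definition nleaves (T : btree) : nat := size (leaves T).

Definition left_child (v : vertex) : vertex := rcons v false.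
Definition right_child (v : vertex) : vertex := rcons v true.

Definition level (v : vertex) : nat := size v.

Definition path_tree (T : btree) : Prop :=
  forall d : nat, count (fun v => level v == d) (vertices T) <= 2.

(* Leaves are numbered from 1, whereas [nth] counts from 0. *)
Definition bottom_leaf (T : btree) (i : nat) : Prop :=
  1 <= i <= nleaves T /\ level (nth [::] (leaves T) i.-1) = nleaves T - 1.

Definition letter := 'I_3.
Definition word := seq letter.

(* [(a, (b, c))] stands for the rule a -> bc. All letters are start symbols, so
   the label of the root is unconstrained in [parses]. *)
Definition rules : seq (letter * (letter * letter)) :=
  [:: (0, (1, 2)); (0, (2, 1));
      (1, (0, 2)); (1, (2, 0));
      (2, (0, 1)); (2, (1, 0))]%R.

(* The values of [f] at addresses that are not vertices of [T] are irrelevant. *)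
Definition parses (T : btree) (w : word) : Prop :=
  exists f : vertex -> letter,
    [seq f v | v <- leaves T] = w /\
    forall v : vertex, v \in vertices T -> v \notin leaves T ->
      (f v, (f (left_child v), f (right_child v))) \in rules.

Definition single_one (n k : nat) : word :=
  nseq (k - 1) (0%R : letter) ++ (1%R : letter) :: nseq (n - k) (0%R : letter).

(* Main.v *)
(** An n-leaf tree with a leaf on level n - 1 is a spine from which single
    leaves hang.  If that leaf is labeled 1 and all other leaves 0, then the
    labels along the spine, from the bottom up, are 1, 2, 1, 2, ..., never 0, so
    the labeling never gets stuck.  Hence k = i works, unless i is 1 or n; then
    the sibling of the ith leaf is a bottom leaf of both trees, with number 2 or
    n - 1, and it serves as the kth leaf. *)
Require Import Defs.
From mathcomp Require Import all_boot all_order all_algebra.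
From mathcomp Require Import zify.

(* [i] counts from 0. *)
Inductive deepest : btree -> nat -> Prop :=
| deepest_leaf : deepest Leaf 0
| deepest_nodel l i : deepest l i -> deepest (Node l Leaf) i
| deepest_noder r i : deepest r i -> deepest (Node Leaf r) i.+1.

Lemma nleaves_node l r : nleaves (Node l r) = nleaves l + nleaves r.
Proof. by rewrite /nleaves /= size_cat !size_map. Qed.

Lemma nleaves_gt0 T : 0 < nleaves T.
Proof. by elim: T => // l IHl r IHr; rewrite nleaves_node addn_gt0 IHl. Qed.

Lemma nleaves_le1 T : nleaves T <= 1 -> T = Leaf.
Proof.
case: T => // l r; rewrite nleaves_node.
by have := nleaves_gt0 l; have := nleaves_gt0 r; lia.
Qed.

Lemma level_leaf T v : v \in leaves T -> level v < nleaves T.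
Proof.
rewrite /level; elim: T v => [|l IHl r IHr] v; first by rewrite inE => /eqP->.
have := nleaves_gt0 l; have := nleaves_gt0 r; rewrite nleaves_node => r0 l0.
rewrite mem_cat => /orP[] /mapP[u uT ->] /=.
  by have := IHl _ uT; lia.
by have := IHr _ uT; lia.
Qed.

Lemma deepestP T i : i < nleaves T ->
  level (nth [::] (leaves T) i) = (nleaves T).-1 -> deepest T i.
Proof.
rewrite /level; elim: T i => [|l IHl r IHr] i.
  by case: i => // _ _; apply: deepest_leaf.
have l0 := nleaves_gt0 l; have r0 := nleaves_gt0 r.
rewrite nleaves_node /= nth_cat size_map -/(nleaves l) => lt_i.
have [il|li] := ltnP i (nleaves l).
  rewrite (nth_map [::]) //= => eq_lev.
  have lev : size (nth [::] (leaves l) i) < nleaves l.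
    exact/level_leaf/mem_nth.
  (* The leaf lies below level [nleaves l] in [l], yet on level [nleaves l + nleaves r - 2]
     there. *)
  have r1 : nleaves r <= 1 by lia.
  by rewrite (nleaves_le1 _ r1); apply/deepest_nodel/IHl => //; lia.
have ir : i - nleaves l < nleaves r by lia.
rewrite (nth_map [::]) //= => eq_lev.
have lev : size (nth [::] (leaves r) (i - nleaves l)) < nleaves r.
  exact/level_leaf/mem_nth.
have l1 : nleaves l = 1 by lia.
have lL : l = Leaf by apply: nleaves_le1; lia.
have -> : i = (i - nleaves l).+1 by lia.
by rewrite {1}lL; apply/deepest_noder/IHr => //; lia.
Qed.

Lemma bottom_leaf_deepest T i : bottom_leaf T i -> deepest T i.-1.
Proof. by case=> /andP[i0 iT] lev; apply: deepestP; rewrite ?lev; lia. Qed.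

Lemma deepest_lt T i : deepest T i -> i < nleaves T.
Proof.
elim=> // [l|r] {}i _ IH; rewrite nleaves_node; last by rewrite add1n.
by rewrite addn1 ltnW.
Qed.

(** The lowest internal vertex of the spine has two leaves as children; either can serve as the end
    of the spine. *)
Lemma deepest_sibling T i : deepest T i -> 1 < nleaves T ->
  deepest T i.+1 \/ 0 < i /\ deepest T i.-1.
Proof.
elim=> // [l|r] {}i dT IH _.
- have [/IH[d|[i0 d]]|/nleaves_le1 lL] := ltnP 1 (nleaves l).
  + by left; apply: deepest_nodel.
  + by right; split=> //; apply: deepest_nodel.
  (* Both children of the root are leaves here, so the other constructor reaches the sibling. *)
  + by rewrite lL in dT *; left; apply: deepest_noder.
- have [/IH[d|[i0 d]]|/nleaves_le1 rL] := ltnP 1 (nleaves r).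
  + by left; apply: deepest_noder.
  + by right; split=> //; rewrite /= -(prednK i0); apply: deepest_noder.
  + by rewrite rL in dT *; right; split=> //; apply: deepest_nodel.
Qed.

(** Fixing the root label allows labelings of two subtrees to be glued under a new root. *)
Definition parses_from (a : letter) (T : btree) (w : word) : Prop :=
  exists f : vertex -> letter,
    [/\ f [::] = a, [seq f v | v <- leaves T] = w &
      forall v : vertex, v \in vertices T -> v \notin leaves T ->
        (f v, (f (left_child v), f (right_child v))) \in rules].

Lemma parses_from_parses a T w : parses_from a T w -> parses T w.
Proof. by case=> f [_ fw fr]; exists f. Qed.

Lemma parses_from_leaf a : parses_from a Leaf [:: a].
Proof. by exists (fun=> a); split=> // v /= ->. Qed.

Lemma parses_from_node a b c l r u w : (c, (a, b)) \in rules ->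
  parses_from a l u -> parses_from b r w -> parses_from c (Node l r) (u ++ w).
Proof.
move=> abc [f [fa fu fr]] [g [gb gw gr]].
exists (fun v => match v with
                 | [::] => c | false :: v' => f v' | true :: v' => g v' end).
split=> //; first by rewrite /= map_cat -!map_comp -fu -gw.
move=> v; rewrite /= inE mem_cat mem_cat => /orP[/eqP-> _|].
  by rewrite /= fa gb.
case/orP=> /mapP[x xT ->]; rewrite negb_or => /andP[nl nr].
  by apply: fr => //; apply: contra nl => /(map_f (cons false)).
by apply: gr => //; apply: contra nr => /(map_f (cons true)).
Qed.

Lemma single_one_cons n k : 0 < k ->
  single_one n.+1 k.+1 = [:: 0%R] ++ single_one n k.
Proof. by case: k => // k _; rewrite /single_one !subn1 subSS. Qed.

Lemma single_one_rcons n k : k <= n ->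
  single_one n.+1 k = single_one n k ++ [:: 0%R].
Proof.
by move=> kn; rewrite /single_one subSn // -[(n - k).+1]addn1 nseqD -catA.
Qed.

(** Negation modulo 3 swaps 1 and 2, so [a], [-a] and 0 are distinct. *)
Lemma rules_opp (a : letter) : a != 0%R ->
  ((- a)%R, (a, 0%R)) \in rules /\ ((- a)%R, (0%R, a)) \in rules.
Proof. by case: a => [[|[|[|]]]]. Qed.

Lemma deepest_parses T i : deepest T i ->
  exists2 a : letter, a != 0%R & parses_from a T (single_one (nleaves T) i.+1).
Proof.
elim=> [|l {}i d [a a0 p]|r {}i d [a a0 p]].
- by exists 1%R => //; apply: parses_from_leaf.
- exists (- a)%R; first by rewrite GRing.oppr_eq0.
  rewrite nleaves_node addn1 single_one_rcons ?deepest_lt //.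
  by apply: parses_from_node p (parses_from_leaf _); case: (rules_opp _ a0).
- exists (- a)%R; first by rewrite GRing.oppr_eq0.
  rewrite nleaves_node add1n single_one_cons //.
  by apply: parses_from_node (parses_from_leaf _) p; case: (rules_opp _ a0).
Qed.

Theorem proposition9 (n : nat) (hn : 3 <= n) (T1 T2 : btree)
    (hn1 : nleaves T1 = n) (hn2 : nleaves T2 = n)
    (hT1 : path_tree T1) (hT2 : path_tree T2)
    (hbot : exists i : nat, bottom_leaf T1 i /\ bottom_leaf T2 i) :
  exists k : nat, 2 <= k <= n - 1 /\
    parses T1 (single_one n k) /\ parses T2 (single_one n k).
Proof.
case: hbot => i [/bottom_leaf_deepest d1 /bottom_leaf_deepest d2].
(* [j] counts from 0, so k is [j.+1]. *)
suff [j [j_in e1 e2]] : exists j, [/\ 0 < j < n.-1, deepest T1 j & deepest T2 j].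
  exists j.+1; split; first by lia.
  have [a _ p1] := deepest_parses _ _ e1; have [b _ p2] := deepest_parses _ _ e2.
  by rewrite -{1}hn1 -hn2; split; apply: parses_from_parses; eassumption.
move: i.-1 d1 d2 => {}i d1 d2.
have lt1 := deepest_lt _ _ d1; rewrite hn1 in lt1.
have gt1 : 1 < n by lia.
have := deepest_sibling _ _ d2; have := deepest_sibling _ _ d1.
rewrite hn1 hn2 => /(_ gt1) s1 /(_ gt1) s2.
have [i0|i_gt0] := posnP i.
  (* The first leaf has its sibling on the right in both trees. *)
  exists 1; case: s1 s2 => [e1|[]]; last by rewrite i0.
  case=> [e2|[]]; last by rewrite i0.
  by rewrite i0 in e1 e2; split=> //; lia.
have [i_lt|i_ge] := ltnP i n.-1; first by exists i; rewrite i_gt0.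
(* Now [i] is the last leaf, and a sibling on its right would have index at least n. *)
exists i.-1; case: s1 => [/deepest_lt|[_ e1]]; first by rewrite hn1; lia.
case: s2 => [/deepest_lt|[_ e2]]; first by rewrite hn2; lia.
by split=> //; lia.
Qed.
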